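(* Let $\Sigma=(\mathcal{X},\mathcal{X}_0,g,M)$ be an interconnected monotone system consisting of $N$ subsystems $\Sigma_i=(\mathcal{X}_i,\mathcal{X}_{0,i},\mathcal{W}_i,g_i)$, with unsafe set $\mathcal{X}_u=\prod_{i=1}^N\mathcal{X}_{u,i}$, $\mathcal{X}_{u,i}\subseteq\mathcal{X}_i$, and with state and input partitions having the covering properties described in the context. Fix $\lambda\ge0$ common to all subsystems. For each $i\in\{1,\ldots,N\}$ let $\mathcal{N}_i:\mathcal{X}_i\to\mathbb{R}$ be (the restriction to $\mathcal{X}_i$ of) a monotone neural network, let $\gamma_i,\eta_i\in\mathbb{R}$, and let $X_i=\begin{bmatrix} X_i^{11} & X_i^{12} \\ X_i^{21} & X_i^{22} \end{bmatrix}\in\mathbb{R}^{(m_i+n_i)\times(m_i+n_i)}$ be symmetric, such that $$\begin{bmatrix} M \\ I_n \end{bmatrix}^\top\Xi\begin{bmatrix} M \\ I_n \end{bmatrix}\preceq 0,\qquad \sum_{i=1}^N\gamma_i\le 0,\qquad \sum_{i=1}^N\eta_i>0,$$ where $$\Xi:=\begin{bmatrix}\operatorname{diag}(X_1^{11},\ldots,X_N^{11}) & \operatorname{diag}(X_1^{12},\ldots,X_N^{12}) \\ \operatorname{diag}(X_1^{21},\ldots,X_N^{21}) & \operatorname{diag}(X_1^{22},\ldots,X_N^{22})\end{bmatrix}$$ (block-diagonal blocks). Let $L_i^{\mathrm{total}}=L_i^1+L_i^2+L_i^3$, where $$L_i^1=\sum_{j\in\mathcal{I}_i}\big[\mathrm{ReLU}(\mathcal{N}_i(\overline{x}_i^j)-\gamma_i)\big]^2,\qquad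 L_i^2=\sum_{j\in\mathcal{U}_i}\big[\mathrm{ReLU}(\eta_i-\mathcal{N}_i(\underline{x}_i^j))\big]^2,$$ $$L_i^3=\sum_{j\in\mathcal{P}_i,\,k\in\mathcal{Q}_i}\big[\mathrm{ReLU}\big(\mathcal{N}_i(g_i(\overline{x}_i^j,\overline{w}_i^k))-\lambda\mathcal{N}_i(\underline{x}_i^j)-\mathcal{Z}_i^{j,k}\big)\big]^2 .$$ If $L_i^{\mathrm{total}}=0$ for all $i\in\{1,\ldots,N\}$, then each $\mathcal{N}_i$ is an interval-barrier function for $\Sigma_i$ (with associated $\gamma_i,\eta_i,X_i$). Consequently, $\mathcal{N}(x)=\sum_{i=1}^N\mathcal{N}_i(x_i)$ is a barrier certificate for $\Sigma$ with respect to $\mathcal{X}_u$, and hence $\Sigma$ is safe with respect to $\mathcal{X}_u$.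
   Context: Notation: for vectors, $x\le y$ is coordinatewise; $[\underline{x},\overline{x}]=\{x:\underline{x}\le x\le\overline{x}\}$ (with $\underline{x}\le\overline{x}$); $A\preceq 0$ means the symmetric matrix $A$ is negative semidefinite; $I_n$ is the identity; $\mathrm{ReLU}(s)=\max(0,s)$. Interconnected system: for $i\in\{1,\ldots,N\}$, $\Sigma_i=(\mathcal{X}_i,\mathcal{X}_{0,i},\mathcal{W}_i,g_i)$ has state set $\mathcal{X}_i\subseteq\mathbb{R}^{n_i}$, initial set $\mathcal{X}_{0,i}\subseteq\mathcal{X}_i$, internal input set $\mathcal{W}_i\subseteq\mathbb{R}^{m_i}$ and transition map $g_i:\mathcal{X}_i\times\mathcal{W}_i\to\mathcal{X}_i$, with $x_i^+=g_i(x_i,w_i)$. The subsystems are interconnected through $w=Mx$, where $x=(x_1^\top,\ldots,x_N^\top)^\top$, $w=(w_1^\top,\ldots,w_N^\top)^\top$, $M\in\mathbb{R}^{m\times n}$, $n=\sum_i n_i$, $m=\sum_i m_i$. Write $(Mx)_i\in\mathbb{R}^{m_i}$ for the $i$-th block of $Mx$; it is required that $(Mx)_i\in\mathcal{W}_i$ for all $x\in\prod_i\mathcal{X}_i$. The interconnected system is $\Sigma=(\mathcal{X},\mathcal{X}_0,g,M)$ with $\mathcal{X}=\prod_i\mathcal{X}_i$, $\mathcal{X}_0=\prod_i\mathcal{X}_{0,i}$, and $g:\mathcal{X}\to\mathcal{X}$, $g(x)=(g_1(x_1,(Mx)_1)^\top,\ldots,g_N(x_N,(Mx)_N)^\top)^\top$.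 It is an interconnected monotone system if each $\Sigma_i$ is monotone: $x\le y$ and $w\le v$ imply $g_i(x,w)\le g_i(y,v)$. Partitions: for each $i$ there are finite families of hyper-rectangles $\{[\underline{x}_i^j,\overline{x}_i^j]\}_{j\in\mathcal{P}_i}$ and $\{[\underline{w}_i^k,\overline{w}_i^k]\}_{k\in\mathcal{Q}_i}$ with $\mathcal{X}_i=\bigcup_{j\in\mathcal{P}_i}[\underline{x}_i^j,\overline{x}_i^j]$ and $\mathcal{W}_i=\bigcup_{k\in\mathcal{Q}_i}[\underline{w}_i^k,\overline{w}_i^k]$, and index sets $\mathcal{I}_i,\mathcal{U}_i\subseteq\mathcal{P}_i$ with $\mathcal{X}_{0,i}\subseteq\bigcup_{j\in\mathcal{I}_i}[\underline{x}_i^j,\overline{x}_i^j]$ and $\mathcal{X}_{u,i}\subseteq\bigcup_{j\in\mathcal{U}_i}[\underline{x}_i^j,\overline{x}_i^j]$. Monotone neural network: a feedforward network $\mathcal{N}:\mathbb{R}^{n_0}\to\mathbb{R}$ with $L$ hidden layers, given by $y^0=x$, $y^{\ell+1}=\sigma(W^\ell y^\ell+b^\ell)$ for $\ell=0,\ldots,L-1$, and $\mathcal{N}(x)=W^Ly^L+b^L$, where the activation $\sigma:\mathbb{R}\to\mathbb{R}$ is nondecreasing and applied elementwise, and all weight matrices $W^0,\ldots,W^L$ are entrywise nonnegative. Interval product: for hyper-rectangles $[\underline{a},\overline{a}]\subseteq\mathbb{R}^p$, $[\underline{b},\overline{b}]\subseteq\mathbb{R}^q$ and $X\in\mathbb{R}^{p\times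 q}$, $$[\underline{a},\overline{a}]^\top X[\underline{b},\overline{b}]:=\sum_{r=1}^p\sum_{s=1}^q\min\{X_{rs}\underline{a}_r\underline{b}_s,\;X_{rs}\underline{a}_r\overline{b}_s,\;X_{rs}\overline{a}_r\underline{b}_s,\;X_{rs}\overline{a}_r\overline{b}_s\}.$$ For a symmetric matrix $X_i$ with blocks $X_i^{11}\in\mathbb{R}^{m_i\times m_i}$, $X_i^{12}\in\mathbb{R}^{m_i\times n_i}$, $X_i^{21}=(X_i^{12})^\top$, $X_i^{22}\in\mathbb{R}^{n_i\times n_i}$, set $$\mathcal{Z}_i^{j,k}=[\underline{w}_i^k,\overline{w}_i^k]^\top X_i^{11}[\underline{w}_i^k,\overline{w}_i^k]+[\underline{w}_i^k,\overline{w}_i^k]^\top X_i^{12}[\underline{x}_i^j,\overline{x}_i^j]+[\underline{x}_i^j,\overline{x}_i^j]^\top X_i^{21}[\underline{w}_i^k,\overline{w}_i^k]+[\underline{x}_i^j,\overline{x}_i^j]^\top X_i^{22}[\underline{x}_i^j,\overline{x}_i^j].$$ Interval-barrier function: with $\lambda\ge0$ fixed (common to all subsystems), a monotone function $\mathcal{B}_i:\mathcal{X}_i\to\mathbb{R}$ (i.e. $x\le y\Rightarrow\mathcal{B}_i(x)\le\mathcal{B}_i(y)$) is an interval-barrier function for $\Sigma_i$, with associated scalars $\gamma_i,\eta_i\in\mathbb{R}$ and symmetric matrix $X_i$, if (1) $\mathcal{B}_i(\overline{x}_i^j)\le\gamma_i$ for all $j\in\mathcal{I}_i$; (2) $\mathcal{B}_i(\underline{x}_i^j)\ge\eta_i$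 for all $j\in\mathcal{U}_i$; (3) $\mathcal{B}_i(g_i(\overline{x}_i^j,\overline{w}_i^k))\le\lambda\mathcal{B}_i(\underline{x}_i^j)+\mathcal{Z}_i^{j,k}$ for all $j\in\mathcal{P}_i$, $k\in\mathcal{Q}_i$. Barrier certificate (for the overall system $x^+=g(x)$): a function $\mathcal{B}:\mathcal{X}\to\mathbb{R}$ is a barrier certificate with respect to $\mathcal{X}_u$ if there are $\gamma\le\delta\le\eta$ in $\mathbb{R}$ with $\mathcal{B}(x)\le\gamma$ for all $x\in\mathcal{X}_0$; $\mathcal{B}(x)>\eta$ for all $x\in\mathcal{X}_u$; and, for all $x\in\mathcal{X}$, $\mathcal{B}(x)\le\delta$ implies $\mathcal{B}(g(x))\le\delta$. Safety: $\Sigma$ is safe with respect to $\mathcal{X}_u$ if every trajectory $x_{t+1}=g(x_t)$ with $x_0\in\mathcal{X}_0$ satisfies $x_t\notin\mathcal{X}_u$ for all $t\ge0$. *)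

(* Defs.v *)
From mathcomp Require Import all_boot all_order all_algebra.
From mathcomp Require Import classical_sets reals.

Set Implicit Arguments.
Unset Strict Implicit.
Unset Printing Implicit Defensive.

Import Order.TTheory GRing.Theory Num.Theory.

Local Open Scope classical_set_scope.
Local Open Scope ring_scope.

Definition vle (R : realType) (d : nat) (x y : 'cV[R]_d) : Prop :=
  forall r : 'I_d, x r 0 <= y r 0.

Definition nsd_mx (R : realType) (d : nat) (A : 'M[R]_d) : Prop :=
  A^T = A /\ forall x : 'cV[R]_d, (x^T *m A *m x) 0 0 <= 0.

(* The rectangular analogue of mxdiag.  As there, conform_mx only serves to
   type the block: when i = j it is F i itself. *)
Definition mxdiag_rect (R : realType) (N : nat) (p q : 'I_N -> nat)
    (F : forall i : 'I_N, 'M[R]_(p i, q i)) :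
    'M[R]_(\sum_i p i, \sum_i q i) :=
  \mxblock_(i, j) (if i == j then conform_mx 0 (F i) else 0).

Definition relu (R : realType) (s : R) : R := Num.max 0 s.

Record box (R : realType) (d : nat) := Box {
  lo : 'cV[R]_d;
  hi : 'cV[R]_d;
  lo_le_hi : vle lo hi }.

Definition box_set (R : realType) (d : nat) (b : box R d) : set 'cV[R]_d :=
  [set x | vle (lo b) x /\ vle x (hi b)].

Definition box_prod (R : realType) (p q : nat)
    (a : box R p) (X : 'M[R]_(p, q)) (b : box R q) : R :=
  \sum_(r < p) \sum_(s < q)
    Num.min (Num.min (X r s * lo a r 0 * lo b s 0) (X r s * lo a r 0 * hi b s 0))
            (Num.min (X r s * hi a r 0 * lo b s 0) (X r s * hi a r 0 * hi b s 0)).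

(* The scalar Z^{j,k}, for the input box w = w^k and the state box x = x^j. *)
Definition supply (R : realType) (n m : nat) (X : 'M[R]_(m + n))
    (w : box R m) (x : box R n) : R :=
  box_prod w (ulsubmx X) w + box_prod w (ursubmx X) x
  + box_prod x (dlsubmx X) w + box_prod x (drsubmx X) x.

(* The transition map is a total function, constrained (and used) only on
   state_set x input_set, which it maps into state_set. *)
Record subsystem (R : realType) (n m : nat) := Subsystem {
  state_set : set 'cV[R]_n;
  init_set : set 'cV[R]_n;
  input_set : set 'cV[R]_m;
  step : 'cV[R]_n -> 'cV[R]_m -> 'cV[R]_n;
  init_sub : init_set `<=` state_set;
  step_state : forall x w, state_set x -> input_set w -> state_set (step x w) }.

Definition monotone_subsystem (R : realType) (n m : nat)
    (S : subsystem R n m) : Prop :=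
  forall x y w v, state_set S x -> state_set S y ->
    input_set S w -> input_set S v ->
    vle x y -> vle w v -> vle (step S x w) (step S y v).

(* Product of subsets of R^(n_1), ..., R^(n_N), as a subset of the space of
   stacked vectors. *)
Definition prod_set (R : realType) (N : nat) (n : 'I_N -> nat)
    (A : forall i : 'I_N, set 'cV[R]_(n i)) : set 'cV[R]_(\sum_i n i) :=
  [set x | forall i : 'I_N, A i (submxcol x i)].

Record interconnected (R : realType) (N : nat) (n m : 'I_N -> nat) :=
  Interconnected {
  sub : forall i : 'I_N, subsystem R (n i) (m i);
  coupling : 'M[R]_(\sum_i m i, \sum_i n i);
  coupling_input : forall x, prod_set (fun i => state_set (sub i)) x ->
    forall i : 'I_N, input_set (sub i) (submxcol (coupling *m x) i) }.

Section Interconnected.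
Context (R : realType) (N : nat) (n m : 'I_N -> nat).
Variable S : interconnected R n m.

Definition sys_state : set 'cV[R]_(\sum_i n i) :=
  prod_set (fun i => state_set (sub S i)).

Definition sys_init : set 'cV[R]_(\sum_i n i) :=
  prod_set (fun i => init_set (sub S i)).

Definition sys_step (x : 'cV[R]_(\sum_i n i)) : 'cV[R]_(\sum_i n i) :=
  \mxcol_i step (sub S i) (submxcol x i) (submxcol (coupling S *m x) i).

Definition interconnected_monotone : Prop :=
  forall i : 'I_N, monotone_subsystem (sub S i).

End Interconnected.

Definition barrier_certificate (R : realType) (T : Type)
    (X X0 Xu : set T) (g : T -> T) (B : T -> R) : Prop :=
  exists gamma delta eta : R,
    [/\ gamma <= delta /\ delta <= eta,
        forall x, X0 x -> B x <= gamma,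
        forall x, Xu x -> eta < B x
      & forall x, X x -> B x <= delta -> B (g x) <= delta].

Definition safe (T : Type) (X0 Xu : set T) (g : T -> T) : Prop :=
  forall x : nat -> T,
    X0 (x 0%N) -> (forall t, x t.+1 = g (x t)) -> forall t, ~ Xu (x t).

Definition interval_barrier (R : realType) (n m : nat) (S : subsystem R n m)
    (P Q : finType) (xbox : P -> box R n) (wbox : Q -> box R m)
    (I U : {set P}) (lambda : R) (B : 'cV[R]_n -> R)
    (gamma eta : R) (X : 'M[R]_(m + n)) : Prop :=
  X^T = X /\
  (forall x y, state_set S x -> state_set S y -> vle x y -> B x <= B y) /\
  [/\ forall j, j \in I -> B (hi (xbox j)) <= gamma,
      forall j, j \in U -> eta <= B (lo (xbox j))
    & forall j k, B (step S (hi (xbox j)) (hi (wbox k)))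
                  <= lambda * B (lo (xbox j)) + supply X (wbox k) (xbox j)].

(* Width of the vector y^l, for input dimension d and hidden widths h. *)
Definition layer_width (d : nat) (h : nat -> nat) (l : nat) : nat :=
  if l is l'.+1 then h l' else d.

(* A scalar-valued feedforward network.  The weights and biases of hidden
   layers are used only at indices l < depth; those of the output layer are
   out_weight and out_bias. *)
Record network (R : realType) (d : nat) := Network {
  depth : nat;
  hwidth : nat -> nat;
  activation : R -> R;
  weight : forall l : nat,
    'M[R]_(layer_width d hwidth l.+1, layer_width d hwidth l);
  bias : forall l : nat, 'cV[R]_(layer_width d hwidth l.+1);
  out_weight : 'rV[R]_(layer_width d hwidth depth);
  out_bias : R }.

Fixpoint layer (R : realType) (d : nat) (F : network R d) (x : 'cV[R]_d)
    (l : nat) : 'cV[R]_(layer_width d (hwidth F) l) :=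
  if l is l'.+1
  then map_mx (activation F) (weight F l' *m layer F x l' + bias F l')
  else x.

Definition net_fun (R : realType) (d : nat) (F : network R d)
    (x : 'cV[R]_d) : R :=
  (out_weight F *m layer F x (depth F)) 0 0 + out_bias F.

Definition monotone_network (R : realType) (d : nat) (F : network R d) : Prop :=
  [/\ forall s t : R, s <= t -> activation F s <= activation F t,
      forall l, (l < depth F)%N -> forall r c, 0 <= weight F l r c
    & forall c, 0 <= out_weight F 0 c].

Section Loss.
Context (R : realType) (n m : nat) (S : subsystem R n m) (P Q : finType).
Variables (xbox : P -> box R n) (wbox : Q -> box R m) (I U : {set P}).
Variables (lambda : R) (B : 'cV[R]_n -> R) (gamma eta : R) (X : 'M[R]_(m + n)).

Definition loss_init : R :=
  \sum_(j in I) relu (B (hi (xbox j)) - gamma) ^+ 2.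

Definition loss_unsafe : R :=
  \sum_(j in U) relu (eta - B (lo (xbox j))) ^+ 2.

Definition loss_step : R :=
  \sum_(j : P) \sum_(k : Q)
    relu (B (step S (hi (xbox j)) (hi (wbox k)))
          - lambda * B (lo (xbox j)) - supply X (wbox k) (xbox j)) ^+ 2.

Definition loss_total : R := loss_init + loss_unsafe + loss_step.

End Loss.

(* Main.v *)
(* Every box Z^{j,k} bounds from below the quadratic supply of X_i at each point
   (w_i, x_i) of the box, so monotonicity of N_i and g_i turns condition (3) on
   the box corners into N_i(g_i(x_i, w_i)) <= lambda N_i(x_i) + supply for all
   (x_i, w_i).  Summing over i with w = M x, the supplies add up to the quadratic
   form of the matrix assumed negative semidefinite, whence
   N(g(x)) <= lambda N(x), and the sublevel set N <= 0 is invariant. *)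

Require Import Defs.
From mathcomp Require Import all_boot all_order all_algebra.
From mathcomp Require Import classical_sets reals.

Set Implicit Arguments.
Unset Strict Implicit.
Unset Printing Implicit Defensive.

Import Order.TTheory GRing.Theory Num.Theory.

Local Open Scope classical_set_scope.
Local Open Scope ring_scope.

(** Induction on time carries [X (x t)] along with [B (x t) <= d], since the level is preserved only
    at points of [X]. The level [d] is at most [e], and [B] exceeds [e] on [Xu]. *)
Lemma safe_barrier_certificate (R : realType) (T : Type) (X X0 Xu : set T)
    (g : T -> T) (B : T -> R) :
  X0 `<=` X -> (forall x, X x -> X (g x)) ->
  barrier_certificate X X0 Xu g B -> safe X0 Xu g.
Proof.
move=> X0X gX [c [d [e [[cd de] Bc Be Bd]]]] x x0 xS t.
have [Xt Bt] : X (x t) /\ B (x t) <= d.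
  elim: t => [|t [Xt Bt]]; first by split; [exact: X0X | exact: le_trans (Bc _ x0) cd].
  by rewrite xS; split; [exact: gX | exact: Bd].
by move=> /Be; apply/negP; rewrite -leNgt (le_trans Bt).
Qed.

Section Relu.
Context (R : realType).
Implicit Types s : R.

Lemma sqr_relu_eq0 s : (relu s ^+ 2 == 0) = (s <= 0).
Proof. by rewrite expf_eq0 /relu /= eq_maxl. Qed.

Lemma sum_sqr_relu_eq0 (J : finType) (A : pred J) (F : J -> R) :
  \sum_(j | A j) relu (F j) ^+ 2 = 0 -> forall j, A j -> F j <= 0.
Proof.
move=> /psumr_eq0P F0 j Aj; rewrite -sqr_relu_eq0 F0 // => k _.
exact: sqr_ge0.
Qed.

End Relu.

(** The loss is a sum of squares, so it vanishes only termwise, and [relu s] is zero exactly when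
    [s <= 0]. *)
Lemma loss_total_eq0 (R : realType) (n m : nat) (S : subsystem R n m)
    (P Q : finType) (xbox : P -> box R n) (wbox : Q -> box R m) (I U : {set P})
    (lambda : R) (B : 'cV[R]_n -> R) (gamma eta : R) (X : 'M[R]_(m + n)) :
  loss_total S xbox wbox I U lambda B gamma eta X = 0 ->
  [/\ forall j, j \in I -> B (hi (xbox j)) <= gamma,
      forall j, j \in U -> eta <= B (lo (xbox j))
    & forall j k, B (step S (hi (xbox j)) (hi (wbox k)))
                  <= lambda * B (lo (xbox j)) + supply X (wbox k) (xbox j)].
Proof.
have sum_ge0 (J : finType) (A : pred J) (F : J -> R) :
    0 <= \sum_(j | A j) relu (F j) ^+ 2.
  by apply: sumr_ge0 => j _; exact: sqr_ge0.
move=> /eqP; rewrite /loss_total /loss_init /loss_unsafe /loss_step.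
(* The double sum becomes a sum over pairs, so that all three losses fit [sum_sqr_relu_eq0]. *)
rewrite pair_bigA /= !paddr_eq0 ?addr_ge0 //.
case/andP=> /andP[] /eqP/sum_sqr_relu_eq0 LI /eqP/sum_sqr_relu_eq0 LU.
move=> /eqP/sum_sqr_relu_eq0 LS.
split=> [j /LI | j /LU | j k]; rewrite ?subr_le0 //.
by have := LS (j, k) isT; rewrite /= -addrA -opprD subr_le0.
Qed.

Section MonotoneNetwork.
Context (R : realType).

Lemma vle_mulmx (p q : nat) (A : 'M[R]_(p, q)) (x y : 'cV[R]_q) :
  (forall r c, 0 <= A r c) -> vle x y -> vle (A *m x) (A *m y).
Proof.
move=> A0 xy r; rewrite !mxE; apply: ler_sum => c _.
by apply: ler_wpM2l; [exact: A0 | exact: xy].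
Qed.

(** Nonnegative weights, a common bias and a nondecreasing activation each preserve the order. The
    bound on [l] is there because weights are known to be nonnegative only below [depth F]. *)
Lemma layer_vle (d : nat) (F : network R d) (x y : 'cV[R]_d) (l : nat) :
  monotone_network F -> (l <= depth F)%N -> vle x y ->
  vle (layer F x l) (layer F y l).
Proof.
move=> [mono W0 _] + xy; elim: l => [//|l IHl] ld r /=.
rewrite mxE [leRHS]mxE; apply: mono.
rewrite mxE [leRHS]mxE lerD2r; apply: vle_mulmx => //; first exact: W0.
exact/IHl/ltnW.
Qed.

Lemma net_fun_vle (d : nat) (F : network R d) (x y : 'cV[R]_d) :
  monotone_network F -> vle x y -> net_fun F x <= net_fun F y.
Proof.
move=> mF xy; rewrite /net_fun lerD2r; apply: vle_mulmx.
  by move=> r c; rewrite ord1; case: mF.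
exact: layer_vle.
Qed.

End MonotoneNetwork.

Section IntervalProduct.
Context (R : realType).

(** A linear function on an interval is minimal at the left or the right endpoint, according to the
    sign of [c]. *)
Lemma ge_min_mul_itv (c a b x : R) :
  a <= x <= b -> Num.min (c * a) (c * b) <= c * x.
Proof.
move=> /andP[ax xb]; rewrite ge_min; have [c0|/ltW c0] := leP 0 c.
  by rewrite ler_wpM2l.
by rewrite [X in _ || X]ler_wnM2l ?orbT.
Qed.

(** Each summand is bilinear in [x r 0] and [y s 0], hence minimal over its rectangle at one of the
    four corners. *)
Lemma box_prod_le (p q : nat) (a : box R p) (X : 'M[R]_(p, q)) (b : box R q)
    (x : 'cV[R]_p) (y : 'cV[R]_q) :
  box_set a x -> box_set b y -> box_prod a X b <= (x^T *m X *m y) 0 0.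
Proof.
move=> [ax xa] [by_ yb].
have -> : (x^T *m X *m y) 0 0 = \sum_r \sum_s X r s * x r 0 * y s 0.
  rewrite mxE; under eq_bigr do rewrite mxE big_distrl.
  rewrite exchange_big; apply: eq_bigr => r _; apply: eq_bigr => s _ /=.
  by rewrite mxE [x r 0 * _]mulrC.
apply: ler_sum => r _; apply: ler_sum => s _.
have itvx : lo a r 0 <= x r 0 <= hi a r 0 by rewrite ax xa.
have itvy : lo b s 0 <= y s 0 <= hi b s 0 by rewrite by_ yb.
have min_le u :
    Num.min (X r s * u * lo b s 0) (X r s * u * hi b s 0) <= X r s * u * y s 0.
  exact: ge_min_mul_itv.
(* With [y s 0] fixed, the first factor moves to an endpoint; [min_le] then treats the second factor
   at each of the two endpoints. *)
have := ge_min_mul_itv (X r s * y s 0) itvx.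
rewrite ![X r s * y s 0 * _]mulrAC; apply: le_trans.
by rewrite le_min; apply/andP; split; rewrite ge_min min_le ?orbT.
Qed.

Lemma supply_le (n m : nat) (X : 'M[R]_(m + n)) (bw : box R m) (bx : box R n)
    (w : 'cV[R]_m) (x : 'cV[R]_n) :
  box_set bw w -> box_set bx x ->
  supply X bw bx <= ((col_mx w x)^T *m X *m col_mx w x) 0 0.
Proof.
move=> bww bxx.
rewrite -{2}[X]submxK tr_col_mx mul_row_block mul_row_col !mulmxDl.
rewrite [leRHS]mxE mxE [X in _ <= _ + X]mxE.
rewrite [leRHS](_ : _ = (w^T *m ulsubmx X *m w) 0 0 + (w^T *m ursubmx X *m x) 0 0
  + (x^T *m dlsubmx X *m w) 0 0 + (x^T *m drsubmx X *m x) 0 0).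
  by rewrite /supply !lerD ?box_prod_le.
(* The block product lists the two mixed terms in the order opposite to that of [supply]. *)
by rewrite -!addrA; congr (_ + _); rewrite addrCA.
Qed.

End IntervalProduct.

Lemma lo_box_set (R : realType) (d : nat) (b : box R d) : box_set b (lo b).
Proof. by split=> [r|]; [exact: lexx | exact: lo_le_hi]. Qed.

Lemma hi_box_set (R : realType) (d : nat) (b : box R d) : box_set b (hi b).
Proof. by split=> [|r]; [exact: lo_le_hi | exact: lexx]. Qed.

Section BlockForms.
Context (R : realType) (N : nat).

Lemma form_mxdiag_rect (p q : 'I_N -> nat)
    (F : forall i, 'M[R]_(p i, q i))
    (x : 'cV[R]_(\sum_i p i)) (y : 'cV[R]_(\sum_i q i)) :
  x^T *m mxdiag_rect F *m y =
  \sum_i ((submxcol x i)^T *m F i *m submxcol y i).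
Proof.
rewrite -{1}[x]submxcolK -{1}[y]submxcolK tr_mxcol mul_mxrow_mxblock.
rewrite mul_mxrow_mxcol; apply: eq_bigr => j _; congr (_ *m _).
rewrite (bigD1 j) //= eqxx conform_mx_id big1 ?addr0 // => i /negbTE ->.
by rewrite mulmx0.
Qed.

(** The global vector stacks all inputs before all states. Block-diagonality splits each of the four
    forms over the subsystems, and the terms are then regrouped by [i]. *)
Lemma form_supply (n m : 'I_N -> nat) (X : forall i, 'M[R]_(m i + n i))
    (w : 'cV[R]_(\sum_i m i)) (x : 'cV[R]_(\sum_i n i)) :
  (col_mx w x)^T *m
    block_mx
      (\mxdiag_i ulsubmx (X i)) (mxdiag_rect (fun i => ursubmx (X i)))
      (mxdiag_rect (fun i => dlsubmx (X i))) (\mxdiag_i drsubmx (X i))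
    *m col_mx w x =
  \sum_i ((col_mx (submxcol w i) (submxcol x i))^T *m X i
            *m col_mx (submxcol w i) (submxcol x i)).
Proof.
(* On square blocks [mxdiag] and [mxdiag_rect] are convertible, so [form_mxdiag_rect] applies to all
   four blocks. *)
rewrite -[mxdiag (fun i => ulsubmx _)]/(mxdiag_rect (fun i => ulsubmx (X i))).
rewrite -[mxdiag (fun i => drsubmx _)]/(mxdiag_rect (fun i => drsubmx (X i))).
rewrite tr_col_mx mul_row_block mul_row_col !mulmxDl !form_mxdiag_rect.
rewrite -!big_split; apply: eq_bigr => i _ /=.
by rewrite -[in RHS](submxK (X i)) tr_col_mx mul_row_block mul_row_col !mulmxDl.
Qed.

End BlockForms.

Section SubsystemBounds.
Context (R : realType) (n m : nat) (S : subsystem R n m) (P Q : finType).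
Variables (xbox : P -> box R n) (wbox : Q -> box R m) (I U : {set P}).
Variables (lambda : R) (B : 'cV[R]_n -> R) (gamma eta : R) (X : 'M[R]_(m + n)).
Hypothesis state_cover : state_set S = \bigcup_j box_set (xbox j).
Hypothesis barB : interval_barrier S xbox wbox I U lambda B gamma eta X.

(** This makes box corners legitimate states, where the monotonicity of [B] and of the transition
    map may be used. *)
Lemma box_sub_state j : box_set (xbox j) `<=` state_set S.
Proof. by move=> x xj; rewrite state_cover; exists j. Qed.

Lemma interval_barrier_init (A : set 'cV[R]_n) :
  A `<=` \bigcup_(j in [set j | j \in I]) box_set (xbox j) ->
  forall x, A x -> B x <= gamma.
Proof.
move=> AI x /AI[j jI xj]; have [_ [monoB [BI _ _]]] := barB.
apply: le_trans (BI _ jI).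
by apply: monoB (proj2 xj); apply: (@box_sub_state j) => //; exact: hi_box_set.
Qed.

Lemma interval_barrier_unsafe (A : set 'cV[R]_n) :
  A `<=` \bigcup_(j in [set j | j \in U]) box_set (xbox j) ->
  forall x, A x -> eta <= B x.
Proof.
move=> AU x /AU[j jU xj]; have [_ [monoB [_ BU _]]] := barB.
apply: le_trans (BU _ jU) _.
by apply: monoB (proj1 xj); apply: (@box_sub_state j) => //; exact: lo_box_set.
Qed.

Lemma interval_barrier_step x w :
  input_set S = \bigcup_k box_set (wbox k) -> monotone_subsystem S ->
  0 <= lambda -> state_set S x -> input_set S w ->
  B (step S x w) <= lambda * B x + ((col_mx w x)^T *m X *m col_mx w x) 0 0.
Proof.
move=> input_cover monoS lambda0 Sx Sw; have [_ [monoB [_ _ BS]]] := barB.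
have [j _ xj] : (\bigcup_j box_set (xbox j)) x by rewrite -state_cover.
have [k _ wk] : (\bigcup_k box_set (wbox k)) w by rewrite -input_cover.
have Shi : state_set S (hi (xbox j)) by exact/box_sub_state/hi_box_set.
have Slo : state_set S (lo (xbox j)) by exact/box_sub_state/lo_box_set.
have Whi : input_set S (hi (wbox k)).
  by rewrite input_cover; exists k => //; exact: hi_box_set.
(* Moving up to the upper corners can only increase the left side; moving down to [lo (xbox j)] can
   only decrease [lambda * B x], as [lambda] is nonnegative. *)
apply: (@le_trans _ _ (B (step S (hi (xbox j)) (hi (wbox k))))).
  apply: monoB; [exact: step_state | exact: step_state |].
  by apply: monoS => //; [case: xj | case: wk].
apply: le_trans (BS j k) _; apply: lerD; last exact: supply_le.
by apply: ler_wpM2l => //; apply: monoB (proj1 xj).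
Qed.

End SubsystemBounds.

Theorem theorem4 (R : realType) (N : nat) (n m : 'I_N -> nat)
  (S : interconnected R n m) (hS : interconnected_monotone S)
  (Xu : forall i : 'I_N, set 'cV[R]_(n i))
  (hXu : forall i, Xu i `<=` state_set (sub S i))
  (P Q : 'I_N -> finType)
  (xbox : forall i : 'I_N, P i -> box R (n i))
  (wbox : forall i : 'I_N, Q i -> box R (m i))
  (I U : forall i : 'I_N, {set P i})
  (hX : forall i, state_set (sub S i) = \bigcup_j box_set (xbox i j))
  (hW : forall i, input_set (sub S i) = \bigcup_k box_set (wbox i k))
  (hI : forall i, init_set (sub S i)
          `<=` \bigcup_(j in [set j | j \in I i]) box_set (xbox i j))
  (hU : forall i, Xu i
          `<=` \bigcup_(j in [set j | j \in U i]) box_set (xbox i j))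
  (lambda : R) (hlambda : 0 <= lambda)
  (NN : forall i : 'I_N, network R (n i))
  (hNN : forall i, monotone_network (NN i))
  (gamma eta : 'I_N -> R)
  (X : forall i : 'I_N, 'M[R]_(m i + n i))
  (hsym : forall i, (X i)^T = X i)
  (hXi :
    let Xi := block_mx
      (\mxdiag_i ulsubmx (X i)) (mxdiag_rect (fun i => ursubmx (X i)))
      (mxdiag_rect (fun i => dlsubmx (X i))) (\mxdiag_i drsubmx (X i)) in
    nsd_mx ((col_mx (coupling S) 1%:M)^T *m Xi *m col_mx (coupling S) 1%:M))
  (hgamma : \sum_i gamma i <= 0)
  (heta : 0 < \sum_i eta i)
  (hloss : forall i,
    loss_total (sub S i) (xbox i) (wbox i) (I i) (U i) lambda
      (net_fun (NN i)) (gamma i) (eta i) (X i) = 0) :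
  [/\ forall i,
        interval_barrier (sub S i) (xbox i) (wbox i) (I i) (U i) lambda
          (net_fun (NN i)) (gamma i) (eta i) (X i),
      barrier_certificate (sys_state S) (sys_init S) (prod_set Xu) (sys_step S)
        (fun x => \sum_i net_fun (NN i) (submxcol x i))
    & safe (sys_init S) (prod_set Xu) (sys_step S)].
Proof.
have bar i : interval_barrier (sub S i) (xbox i) (wbox i) (I i) (U i) lambda
    (net_fun (NN i)) (gamma i) (eta i) (X i).
  split; first exact: hsym.
  by split=> [x y _ _|]; [exact: net_fun_vle | exact: loss_total_eq0].
have cert : barrier_certificate (sys_state S) (sys_init S) (prod_set Xu)
    (sys_step S) (fun x => \sum_i net_fun (NN i) (submxcol x i)).
  (* All three levels can be 0: the strict bound on the unsafe set comes from [heta], and at level 0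
     multiplication by any [lambda >= 0] preserves [B x <= 0]. *)
  exists 0, 0, 0; split=> [//|x x0|x xu|x Xx Bx].
  - apply: le_trans hgamma; apply: ler_sum => i _.
    exact: interval_barrier_init (hX i) (bar i) _ (hI i) _ (x0 i).
  - apply: lt_le_trans heta _; apply: ler_sum => i _.
    exact: interval_barrier_unsafe (hX i) (bar i) _ (hU i) _ (xu i).
  - set w := coupling S *m x.
    apply: (@le_trans _ _ (\sum_i (lambda * net_fun (NN i) (submxcol x i) +
      ((col_mx (submxcol w i) (submxcol x i))^T *m X i
        *m col_mx (submxcol w i) (submxcol x i)) 0 0))).
      apply: ler_sum => i _; rewrite mxcolK.
      apply: interval_barrier_step (hX i) (bar i) _ _ (hW i) (hS i) hlambda _ _.
        exact: Xx.
      exact: coupling_input.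
    rewrite big_split /= -mulr_sumr -summxE -form_supply.
    have -> : col_mx w x = col_mx (coupling S) 1%:M *m x.
      by rewrite mul_col_mx mul1mx.
    rewrite -[leRHS](addr0 0); apply: lerD; first exact: mulr_ge0_le0.
    (* The summed supplies are now the negative semidefinite form evaluated at [x]. *)
    by case: hXi => _ /(_ x); rewrite trmx_mul !mulmxA.
split=> //; apply: safe_barrier_certificate cert => [x x0 i | x Xx i].
  exact/init_sub/x0.
by rewrite mxcolK; apply: step_state; [exact: Xx | exact: coupling_input].
Qed.
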